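(* There exists an antichain $\mathcal{F}\subset 2^{\mathbb{N}}$ (i.e. a family of subsets of $\mathbb{N}$ such that for all distinct $A,B\in\mathcal{F}$ we have $A\not\subset B$) such that $$\liminf_{n\rightarrow \infty}\big|\mathcal{F} \cap 2^{[n]}\big| \left( \frac{2^n}{n\log^{46} n} \right)^{-1}>0.$$
   Context: $[n]=\{1,\dots,n\}$ and $2^{[n]}$ denotes the family of all subsets of $[n]$, so $\mathcal{F}\cap 2^{[n]}$ is the set of members of $\mathcal{F}$ contained in $[n]$. *)

(* Defs.v *)
From HB Require Import structures.
From mathcomp Require Import all_boot all_order all_algebra finmap.
From mathcomp Require Import all_classical all_reals all_analysis.

Set Implicit Arguments.
Unset Strict Implicit.
Unset Printing Implicit Defensive.

Import Order.TTheory GRing.Theory Num.Theory.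

Local Open Scope classical_set_scope.

(* The natural numbers start at 1 here, so that [n] = {1, ..., n}. *)
Definition posnat : set nat := [set k | (0 < k)%N].

Definition initseg (n : nat) : set nat := [set k | (1 <= k <= n)%N].

Definition subsets_of (T : Type) (X : set T) : set (set T) :=
  [set A | A `<=` X].

Definition antichain (T : Type) (F : set (set T)) : Prop :=
  forall A B, F A -> F B -> A <> B -> ~ (A `<=` B).

(* fset_set sends infinite sets to fset0, but by this fact it is only applied
   below to finite families. *)
Lemma finite_subsets_initseg (F : set (set nat)) (n : nat) :
  finite_set (F `&` subsets_of (initseg n)).
Proof.
apply: (@sub_finite_set _ _
  ((fun S : {set 'I_n.+1} => [set k | exists2 i, i \in S & val i = k])
     @` [set: {set 'I_n.+1}])); last exact/finite_image/finite_finset.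
move=> A [_ An]; exists [set i : 'I_n.+1 | `[< A i >]]%SET => //.
apply/seteqP; split => [k [i + <-]|k Ak]; first by rewrite finset.inE => /asboolP.
have /andP[_ kn] := An _ Ak.
by exists (Ordinal (kn : (k < n.+1)%N)) => //; rewrite finset.inE; apply/asboolP.
Qed.

Definition count_in (F : set (set nat)) (n : nat) : nat :=
  #|` fset_set (F `&` subsets_of (initseg n)) |%fset.

(* Main.v *)
Require Import Defs.
From HB Require Import structures.
From mathcomp Require Import all_boot all_order all_algebra finmap.
From mathcomp Require Import all_classical all_reals all_analysis.
From mathcomp Require Import zify ring lra.

Import Order.TTheory GRing.Theory Num.Theory.

Local Open Scope classical_set_scope.

(* Maintain for each n an "alive" family U_n of subsets of [n]. Passing from n
   to n + 1, consider all sets A and A + {n+1} with A in U_n; move a few of those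
   of maximal cardinality from the alive family to the antichain. A later set
   meets [n+1] in an alive set, which has at most that maximal cardinality and is
   still alive, so it contains none of the sets moved.
   Let c_i be the number of alive sets of size i, s the maximal size and x_n a
   quota of order 2^n / (n log^2 n). All c_s top sets are moved when c_s is at
   most 2 x_{n+1}, and about x_{n+1} of them otherwise. The sum of x_n / 2^n
   being small, at least 2^(n-1) sets stay alive. The c_i stay log-concave, so
   c_{s-1} < c_s would make c_s maximal, hence of order at least 2^n / n, larger
   than the quota; thus clearing a small top level at least doubles the next one
   and the invariant c_s >= x_n persists, giving x_{n+1} / 2 - 1 moved sets. *)

(** * Log-concave sequences of naturals *)

(** Two separate indices i <= j, rather than i = j only, also exclude internal zeros, and only
    products are compared. *)
Definition logconcave (c : nat -> nat) : Prop :=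
  forall i j, i <= j -> c i * c j.+2 <= c i.+1 * c j.+1.

(** Convolution with (1, 1): the level sizes after each set A is joined by A plus a new element. *)
Definition conv11 (c : nat -> nat) (i : nat) : nat :=
  c i + (if i is i'.+1 then c i' else 0).

(** Both sides expand into four products, and these compare term by term: in each pair the two
    indices move towards each other by one. *)
Lemma logconcave_conv11 (c : nat -> nat) :
  logconcave c -> logconcave (conv11 c).
Proof.
move=> lc i j ij; rewrite /conv11.
have h1 := lc _ _ ij.
have h2 : c i * c j.+1 <= c i.+1 * c j.
  case: j ij {h1} => [|j] ij.
    by move: ij; rewrite leqn0 => /eqP ->; rewrite mulnC.
  by move: ij; rewrite leq_eqVlt => /predU1P[->|/(lc i j)//]; rewrite mulnC.
case: i ij h1 h2 => [|i] ij h1 h2; first by rewrite /= !mulnDl !mulnDr; lia.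
case: j ij h1 h2 => // j ij h1 h2.
have h3 : c i * c j.+3 <= c i.+1 * c j.+2 by apply: lc; lia.
have h4 : c i * c j.+2 <= c i.+1 * c j.+1 by apply: lc; lia.
rewrite /= !mulnDl !mulnDr; lia.
Qed.

(** The reduced term [d t] matters only as the factor of largest index, on the smaller side; beyond
    [t] that side vanishes. *)
Lemma logconcave_trunc (c d : nat -> nat) (t : nat) :
  logconcave c -> (forall i, i < t -> d i = c i) -> d t <= c t ->
  (forall i, t < i -> d i = 0) -> logconcave d.
Proof.
move=> lc dc dt d0 i j ij.
case: (ltngtP j.+2 t) => h; last 2 first.
- by rewrite (d0 j.+2 h) muln0.
- rewrite (dc i); last lia.
  rewrite (dc i.+1); last lia.
  rewrite (dc j.+1); last lia.
  by apply: leq_trans (lc _ _ ij); rewrite leq_mul2l h dt orbT.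
- by rewrite !dc ?lc; lia.
Qed.

(** An ascent at s propagates downwards: c_i c_{s+1} <= c_{i+1} c_s <= c_{i+1} c_{s+1}, and the
    positive c_{s+1} cancels. *)
Lemma logconcave_incr (c : nat -> nat) (s : nat) :
  logconcave c -> c s < c s.+1 -> forall i, i <= s.+1 -> c i <= c s.+1.
Proof.
move=> lc cs.
have step i : i < s.+1 -> c i <= c i.+1.
  rewrite ltnS leq_eqVlt => /predU1P[->|lt_is]; first exact: ltnW.
  case: s lt_is cs => // s lt_is cs.
  have h := lc i s lt_is; rewrite -(leq_pmul2r (m := c s.+2)); last lia.
  by apply: leq_trans h _; rewrite leq_mul2l ltnW ?orbT.
move=> i /subnK; move: (s.+1 - i) => d.
elim: d i => [|d IH] i; first by rewrite add0n => ->.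
rewrite addSnnS => e; apply: leq_trans (IH _ e); apply: step; lia.
Qed.

(** * Construction of the alive families and the layers *)

(* Subsets of [n] are encoded as strictly decreasing lists. *)
Definition lev (U : seq (seq nat)) (i : nat) : nat := count (fun A => size A == i) U.

Lemma size_lev (U : seq (seq nat)) (s : nat) :
  {in U, forall A, size A <= s} -> size U = \sum_(i < s.+1) lev U i.
Proof.
elim: U => [|A U IH] h; first by rewrite big1.
rewrite /lev /= big_split /= -IH; last by move=> B BU; apply: h; rewrite inE BU orbT.
have As : size A < s.+1 by rewrite ltnS; apply: h; rewrite inE eqxx.
rewrite (bigD1 (Ordinal As)) //= eqxx big1 ?addn0 // => i ne.
by case: eqP => // e; case/eqP: ne; apply: val_inj.
Qed.

Definition top_level (s : nat) (U : seq (seq nat)) := [seq A <- U | size A == s].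
Definition below (s : nat) (U : seq (seq nat)) := [seq A <- U | size A < s].
(** With this threshold the level left behind is either empty or has more than [K] sets. *)
Definition quota (K t : nat) : nat := if t <= K.*2 then t else K.

Definition newtop (n s : nat) (U : seq (seq nat)) := map (cons n.+1) (top_level s U).

Definition step (K n : nat) (st : nat * seq (seq nat)) : nat * seq (seq nat) :=
  let: (s, U) := st in
  (if lev U s <= K.*2 then s else s.+1,
   U ++ map (cons n.+1) (below s U) ++ drop (quota K (lev U s)) (newtop n s U)).

Fixpoint state (K : nat -> nat) (n : nat) : nat * seq (seq nat) :=
  if n is m.+1 then step (K n) m (state K m) else (0, [:: [::]]).

Definition height K n := (state K n).1.
Definition alive K n := (state K n).2.

(** The sets moved to the antichain on passing from n to n + 1: the [take] complementary to the
    [drop] in [step]. *)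
Definition layer (K : nat -> nat) (n : nat) : seq (seq nat) :=
  take (quota (K n.+1) (lev (alive K n) (height K n)))
       (newtop n (height K n) (alive K n)).

Lemma aliveS K n : alive K n.+1 = alive K n
  ++ map (cons n.+1) (below (height K n) (alive K n))
  ++ drop (quota (K n.+1) (lev (alive K n) (height K n)))
          (newtop n (height K n) (alive K n)).
Proof. by rewrite /alive /height /=; case: (state K n). Qed.

Lemma heightS K n : height K n.+1 =
  if lev (alive K n) (height K n) <= (K n.+1).*2 then height K n
  else (height K n).+1.
Proof. by rewrite /alive /height /=; case: (state K n). Qed.

Lemma size_newtop n s U : size (newtop n s U) = lev U s.
Proof. by rewrite size_map size_filter. Qed.

Lemma quota_le K t : quota K t <= t.
Proof. by rewrite /quota; case: ifP => //; lia. Qed.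

(** * Members of alive families, and comparability between layers *)

Lemma mem_aliveS K n B : B \in alive K n.+1 ->
  B \in alive K n \/ exists2 A, A \in alive K n & B = n.+1 :: A.
Proof.
rewrite aliveS !mem_cat => /or3P[->|/mapP[A]|/mem_drop/mapP[A]]; first by left.
  by rewrite mem_filter => /andP[_ ? ->]; right; exists A.
by rewrite mem_filter => /andP[_ ? ->]; right; exists A.
Qed.

Lemma alive_wf K n : {in alive K n, forall A,
  sorted gtn A /\ all (fun k => 0 < k <= n) A}.
Proof.
elim: n => [|n IH] B; first by rewrite inE => /eqP ->.
have wk (A : seq nat) :
    all (fun k => 0 < k <= n) A -> all (fun k => 0 < k <= n.+1) A.
  by apply: sub_all => k; lia.
case/mem_aliveS => [/IH[? ?]|[A /IH[sA aA] ->]]; first by split => //; apply: wk.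
split; last by rewrite /= wk //; lia.
rewrite /= path_sortedE; last by move=> ? ? ?; rewrite /gtn /=; lia.
by rewrite sA andbT; apply: sub_all aA => k /=; lia.
Qed.

Lemma height_le K n : height K n <= n.
Proof. by elim: n => // n IH; rewrite heightS; case: ifP; lia. Qed.

Lemma size_aliveS K n : {in alive K n, forall A, size A <= height K n} ->
  {in alive K n.+1, forall A, size A <= (height K n).+1}.
Proof. by move=> h B /mem_aliveS[/h|[A /h ? ->]] //=; lia. Qed.

Lemma size_alive K n : {in alive K n, forall A, size A <= height K n}.
Proof.
elim: n => [|n IH] B; first by rewrite inE => /eqP ->.
rewrite heightS; case: ifP => hK; last exact: size_aliveS.
rewrite aliveS /quota hK -(size_newtop n) drop_size cats0 mem_cat => /orP[/IH//|].
by move=> /mapP[A]; rewrite mem_filter => /andP[? _] ->.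
Qed.

Lemma mem_layer K n B : B \in layer K n -> exists A,
  [/\ A \in alive K n, size A = height K n & B = n.+1 :: A].
Proof.
by move/mem_take/mapP => [A]; rewrite mem_filter => /andP[/eqP ? ?] ->; exists A.
Qed.

Lemma uniq_newtop n s U : uniq U -> uniq (newtop n s U).
Proof. by move=> uU; rewrite map_inj_uniq ?filter_uniq // => ? ? []. Qed.

Lemma uniq_alive K n : uniq (alive K n).
Proof.
elim: n => // n IH; rewrite aliveS.
have fresh A : A \in alive K n -> n.+1 \in A -> False.
  by move=> /alive_wf[_ /allP] h /h; lia.
rewrite !cat_uniq IH map_inj_uniq ?filter_uniq ?drop_uniq ?uniq_newtop //=;
  last by move=> ? ? [].
rewrite andbT; apply/andP; split; apply/hasPn => B.
  rewrite mem_cat => /orP[/mapP|/mem_drop/mapP] [A _ ->]; apply/negP => /fresh; apply;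
  by rewrite inE eqxx.
move=> /mem_drop/mapP[A]; rewrite mem_filter => /andP[/eqP sA _] ->.
apply/negP => /mapP[A']; rewrite mem_filter => /andP[lt _] [e].
by rewrite -e sA ltnn in lt.
Qed.

Lemma uniq_layer K n : uniq (layer K n).
Proof. by rewrite take_uniq // uniq_newtop // uniq_alive. Qed.

(** Old sets lack n + 1, extended sets from below the top are smaller, and [take] and [drop] of a
    duplicate-free list are disjoint. *)
Lemma layer_notin_alive K n B : B \in layer K n -> B \notin alive K n.+1.
Proof.
move=> BL; have [A [AU sA eB]] := mem_layer _ _ _ BL.
rewrite aliveS !mem_cat !negb_or; apply/and3P; split.
- by apply/negP => /alive_wf[_ /allP]/(_ n.+1); rewrite eB inE eqxx => /(_ isT); lia.
- apply/negP => /mapP[A']; rewrite mem_filter => /andP[lt _].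
  by rewrite eB => -[e]; rewrite -e sA ltnn in lt.
- have := uniq_newtop n (height K n) _ (uniq_alive K n).
  rewrite -{1}(cat_take_drop (quota (K n.+1) (lev (alive K n) (height K n)))
                             (newtop _ _ _)).
  rewrite cat_uniq => /and3P[_ /hasPn/(_ B) h _].
  by apply/negP => /h; rewrite [_ \in _]BL.
Qed.

Lemma filter_alive K n d B : B \in alive K (d + n) ->
  [seq k <- B | k <= n] \in alive K n.
Proof.
elim: d B => [|d IH] B.
  move=> BU; rewrite (_ : seq.filter _ _ = B) //; apply/all_filterP.
  by have [_] := alive_wf _ _ _ BU; apply: sub_all => k; lia.
rewrite addSn => /mem_aliveS[/IH//|[A /IH + ->]] /=.
by case: ifP => //; lia.
Qed.

Lemma subset_layers K n m A B : A \in layer K n -> B \in layer K m ->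
  {subset A <= B} -> A = B.
Proof.
move=> AL BL AB.
have [A0 [AU sA eA]] := mem_layer _ _ _ AL.
have [B0 [BU sB eB]] := mem_layer _ _ _ BL.
have gt_trans : transitive gtn by move=> ? ? ?; rewrite /gtn /=; lia.
have gt_irr : irreflexive gtn by move=> ?; rewrite /gtn /= ltnn.
have srt k C0 : C0 \in alive K k -> sorted gtn (k.+1 :: C0).
  move=> /alive_wf[sC aC]; rewrite /= path_sortedE // sC andbT.
  by apply: sub_all aC => ? /=; lia.
have sA' : sorted gtn A by rewrite eA srt.
have uA : uniq A by apply: sorted_uniq sA'.
have eqv C : sorted gtn C -> {subset A <= C} -> size C <= size A -> A = C.
  move=> sC AC le; apply: (irr_sorted_eq gt_trans gt_irr) => //.
  by have [] := uniq_min_size uA AC le.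
case: (ltngtP n m) => nm.
(* The trace C of B on [n+1] is alive, contains A and is no larger than A, so it equals A; but A is
   no longer alive. *)
- have BU' : B0 \in alive K ((m - n.+1) + n.+1) by rewrite subnK.
  move: (filter_alive _ _ _ _ BU'); set C := seq.filter _ _ => CU.
  suff eAC : A = C by move: (layer_notin_alive _ _ _ AL); rewrite eAC CU.
  apply: eqv; first by have [] := alive_wf _ _ _ CU.
    move=> k kA; rewrite mem_filter.
    have kn : k <= n.+1.
      move: kA; rewrite eA inE => /predU1P[->//|].
      by have [_ /allP h] := alive_wf _ _ _ AU => /h; lia.
    rewrite kn /=; move: (AB _ kA); rewrite eB inE => /predU1P[e|//].
    by move: kn; rewrite e; lia.
  by rewrite eA /= sA; apply: size_aliveS CU; apply: size_alive.
- have : n.+1 \in B by apply: AB; rewrite eA inE eqxx.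
  rewrite eB inE => /orP[/eqP|]; first lia.
  by have [_ /allP h] := alive_wf _ _ _ BU => /h; lia.
- by apply: eqv => //; rewrite ?eB ?eA ?srt //= sA sB nm.
Qed.

(** * Level sizes of the alive families *)

Lemma lev_cat U V i : lev (U ++ V) i = lev U i + lev V i.
Proof. exact: count_cat. Qed.

Lemma lev_cons x U i :
  lev (map (cons x) U) i = if i is i'.+1 then lev U i' else 0.
Proof.
rewrite /lev count_map; case: i => [|i]; last by apply: eq_count.
by rewrite (eq_count (a2 := pred0)) ?count_pred0.
Qed.

Lemma lev_below s U i : lev (below s U) i = if i < s then lev U i else 0.
Proof.
rewrite /lev count_filter; case: ifP => h.
  by apply: eq_count => A /=; case: eqP => //= ->.
by rewrite (eq_count (a2 := pred0)) ?count_pred0 // => A /=; case: eqP => //= ->.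
Qed.

Lemma lev_drop_newtop k n s U i :
  lev (drop k (newtop n s U)) i = if i == s.+1 then lev U s - k else 0.
Proof.
have h : all (fun A => size A == s.+1) (drop k (newtop n s U)).
  apply/allP => B /mem_drop/mapP[A]; rewrite mem_filter => /andP[/eqP <- _] ->.
  by rewrite /= eqxx.
case: eqP => [->|ne].
  move: h; rewrite all_count => /eqP; rewrite /lev => ->.
  by rewrite size_drop size_newtop.
apply/eqP; rewrite -leqn0 leqNgt -has_count; apply/hasPn => B /(allP h)/eqP ->.
by apply/eqP => e; apply: ne.
Qed.

Lemma lev_gt U s i : {in U, forall A, size A <= s} -> s < i -> lev U i = 0.
Proof.
move=> h si; apply/eqP; rewrite -leqn0 leqNgt -has_count; apply/hasPn => B /h.
by case: eqP => // ->; lia.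
Qed.

(** The new profile is [conv11] of the old one, truncated at level s + 1, which is where
    log-concavity survives by [logconcave_trunc]. *)
Lemma lev_aliveS K n i : lev (alive K n.+1) i =
  let s := height K n in
  if i <= s then conv11 (lev (alive K n)) i
  else if i == s.+1 then lev (alive K n) s - quota (K n.+1) (lev (alive K n) s)
  else 0.
Proof.
rewrite /= aliveS !lev_cat lev_cons lev_drop_newtop /conv11.
case: (ltnP (height K n) i) => h; last first.
  rewrite (_ : (i == _) = false) ?addn0; last lia.
  by case: i h => // i h; rewrite lev_below h.
rewrite (lev_gt _ _ _ (@size_alive K n) h).
by case: i h => // i h; rewrite lev_below ltnNge -ltnS h.
Qed.

Lemma logconcave_alive K n : logconcave (lev (alive K n)).
Proof.
elim: n => [|n IH]; first by case=> [|i] [|j] _; rewrite /lev //= ?muln0.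
apply: (@logconcave_trunc _ _ (height K n).+1 (logconcave_conv11 _ IH)) =>
  [i h||i h].
all: rewrite lev_aliveS /=.
- by rewrite -ltnS h.
- by rewrite ltnn eqxx /conv11 (lev_gt _ _ _ (@size_alive K n) (ltnSn _)) leq_subr.
- by case: ifP; [lia|case: ifP => //; lia].
Qed.

Lemma size_aliveD K n :
  size (alive K n.+1) + size (layer K n) = (size (alive K n)).*2.
Proof.
rewrite aliveS !size_cat -addnA -addnA (addnC (size (drop _ _))) -size_cat.
rewrite cat_take_drop size_newtop size_map size_filter -addnn; congr addn.
rewrite -(count_predC (fun A => size A < height K n)); congr addn.
by apply: eq_in_count => A /size_alive /=; lia.
Qed.

Lemma size_layer K n :
  size (layer K n) = quota (K n.+1) (lev (alive K n) (height K n)).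
Proof. by rewrite size_take_min size_newtop; apply/minn_idPl/quota_le. Qed.

Lemma lev_doubling K n : let c := lev (alive K n) in let s := height K n in
  n.+1 * c s < size (alive K n) -> (c s).*2 <= conv11 c s.
Proof.
move=> /= big; rewrite /conv11.
case: (height K n) (height_le K n) (@size_alive K n) big => [|s] sn hs big.
  (* At height 0 every alive set lies on level 0, against [big]. *)
  by move: big; rewrite (size_lev _ _ hs) big_ord1 ltnNge leq_pmull.
rewrite -addnn leq_add2l leqNgt; apply/negP => lt.
move: big; rewrite ltnNge => /negP; apply; rewrite (size_lev _ _ hs).
(* The height s + 1 is at most n, so there are at most n + 1 levels, none larger than the top
   one. *)
apply: (@leq_trans (\sum_(i < s.+2) lev (alive K n) s.+1)).
  apply: leq_sum => i _; apply: logconcave_incr => //; first exact: logconcave_alive.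
  by rewrite -ltnS.
by rewrite sum_nat_const card_ord leq_mul2r; apply/orP; right; lia.
Qed.

Local Open Scope ring_scope.

(** * Growth of alive families and layers for real quotas [x] with slack [phi] *)

Section growth.
Variables (R : realType) (x phi : nat -> R).
Hypothesis x_ge0 : forall n, 0 <= x n.
Hypothesis x0_le1 : x 0 <= 1.
Hypothesis x_double : forall n, x n.+1 <= 2 * x n.
Hypothesis x_small : forall n, 4 * n.+1%:R * x n.+1 < 2 ^+ n.
Hypothesis phi_ge0 : forall n, 0 <= phi n.
Hypothesis phi0_le : phi 0 <= 2^-1.
Hypothesis x_phi : forall n, 2 * x n.+1 <= 2 ^+ n.+1 * (phi n - phi n.+1).

Let K (n : nat) : nat := Num.truncn (x n).

Let K_le n : (K n)%:R <= x n.
Proof. by rewrite truncn_le. Qed.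

Let K_gt n : x n < (K n)%:R + 1.
Proof. by rewrite natr1 truncnS_gt. Qed.

(** A step removes at most 2 x_{n+1} sets, lowering the density in 2^[n+1] by at most the decrease
    of [phi], by [x_phi]. *)
Lemma size_alive_ge n : 2 ^+ n * (2^-1 + phi n) <= (size (alive K n))%:R.
Proof.
elim: n => [|n IH].
  by rewrite expr0 mul1r (_ : size _ = 1%N) //; have := phi0_le; lra.
have := congr1 (GRing.natmul (1 : R)) (size_aliveD K n).
rewrite natrD -muln2 natrM size_layer => e.
have h : (quota (K n.+1) (lev (alive K n) (height K n)))%:R <= 2 * x n.+1.
  apply: (@le_trans _ _ ((K n.+1).*2)%:R).
    by rewrite ler_nat /quota; case: ifP; lia.
  by rewrite -mul2n natrM ler_pM2l ?K_le.
have := x_phi n; move: h e IH; rewrite exprS.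
set a := _%:R; set b := _%:R; set c := _%:R; set p := 2 ^+ n.
move: (x n.+1) => t; nra.
Qed.

Lemma lev_top_ge n : x n <= (lev (alive K n) (height K n))%:R.
Proof.
elim: n => [|n IH]; first exact: le_trans x0_le1 _.
rewrite heightS; case: ifPn => h; rewrite lev_aliveS /=.
  (* The top level was cleared and the height stays; [lev_doubling] applies because (n+1) c_s <= 2
     (n+1) x_{n+1} < 2^(n-1). *)
  rewrite leqnn; apply: (le_trans (x_double n)).
  apply: (@le_trans _ _ ((lev (alive K n) (height K n)).*2)%:R).
    by rewrite -mul2n natrM ler_pM2l.
  rewrite ler_nat; apply: lev_doubling; rewrite -(ltr_nat R) natrM.
  apply: (@le_lt_trans _ _ (n.+1%:R * (2 * x n.+1))).
    rewrite ler_pM2l ?ltr0n //; apply: (@le_trans _ _ ((K n.+1).*2)%:R).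
      by rewrite ler_nat.
    by rewrite -mul2n natrM ler_pM2l ?K_le.
  have := size_alive_ge n; have := x_small n; have := phi_ge0 n.
  have : 0 < 2 ^+ n :> R by rewrite exprn_gt0.
  set p := 2 ^+ n; set m := n.+1%:R; set s := _%:R.
  nra.
(* More than 2K sets minus K leaves at least K + 1, which exceeds x_{n+1}. *)
rewrite ltnn eqxx /quota (negbTE h); apply: ltW; apply: lt_le_trans (K_gt _) _.
by rewrite natr1 ler_nat; lia.
Qed.

Lemma size_layer_ge n : x n.+1 / 2 - 1 <= (size (layer K n))%:R.
Proof.
rewrite size_layer /quota; case: ifP => _.
  by have := lev_top_ge n; have := x_double n; lra.
by have := K_gt n.+1; have := x_ge0 n.+1; lra.
Qed.

End growth.

(** * The union of the layers as a family of sets of positive integers *)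

Definition layer_union (K : nat -> nat) : set (set nat) :=
  [set X | exists n A, A \in layer K n /\ X = [set` A]].

Lemma layer_bound K n A k : A \in layer K n -> k \in A -> (0 < k <= n.+1)%N.
Proof.
move=> /mem_layer[B [BU _ ->]]; rewrite inE => /predU1P[->|]; first lia.
by have [_ /allP h] := alive_wf _ _ _ BU => /h; lia.
Qed.

Lemma layer_union_pos K : layer_union K `<=` subsets_of posnat.
Proof.
move=> X [n [A [AL ->]]] k /= kA; rewrite /posnat /=.
by have := layer_bound _ _ _ _ AL kA; lia.
Qed.

Lemma layer_union_antichain K : antichain (layer_union K).
Proof.
move=> X Y [n [A [AL ->]]] [m [B [BL ->]]] ne sub; apply: ne.
by rewrite (subset_layers _ _ _ _ _ AL BL) // => k; apply: sub.
Qed.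

Lemma count_in_layer_union K n :
  (size (layer K n) <= count_in (layer_union K) n.+1)%N.
Proof.
have fin := finite_subsets_initseg (layer_union K) n.+1.
rewrite -(size_map (fun A => [set` A] : set nat)) /count_in.
apply: uniq_leq_size.
  rewrite map_inj_in_uniq ?uniq_layer // => A B AL BL e.
  (* Lists in one layer with the same underlying set are equal, as a case of the antichain
     property. *)
  by apply: subset_layers _ _ _ _ _ AL BL _ => k; have := congr1 (@^~ k) e => /= ->.
move=> X /mapP[A AL ->]; rewrite in_fset_set // inE; split; first by exists n, A.
by move=> k /= /(layer_bound _ _ _ _ AL); rewrite /initseg /=; lia.
Qed.

Lemma limn_einf_gt0 (R : realType) (u : nat -> R) (c : R) (N : nat) :
  0 < c -> (forall n, (N <= n)%N -> c <= u n) ->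
  (0 < limn_einf (fun n => (u n)%:E))%E.
Proof.
move=> c0 h; apply: (@lt_le_trans _ _ c%:E); first by rewrite lte_fin.
rewrite limn_einf_lim; apply: lime_ge; first exact: is_cvg_einfs.
exists N => // n /= Nn; apply/ereal_infP => _ [m /= nm <-].
by rewrite lee_fin h // (leq_trans Nn).
Qed.

(** * Explicit quotas and slack, and their estimates *)

Section quota_sequence.
Variable R : realType.

(** The shift by 4 makes the logarithm at least 1 from n = 0 on. *)
Let L (n : nat) : R := ln (n + 4)%:R.

Let L_ge1 n : 1 <= L n.
Proof.
rewrite -[leLHS](@expRK R) ler_ln ?posrE ?expR_gt0 ?ltr0n ?addn4 //.
apply: (@le_trans _ _ 4%:R); last by rewrite ler_nat.
(* e <= 4, because e^(-1/2) >= 1/2. *)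
have := expR_ge1Dx (- 2^-1 : R); have := expR_gt0 (- 2^-1 : R).
have : expR (- 2^-1) ^+ 2 * expR 1 = 1 :> R.
  by rewrite expr2 -!expRD -[RHS](@expR0 R); congr expR; lra.
set a := expR _; set b := expR _ => ab a0 a2.
have b0 : 0 < b by exact: expR_gt0.
have a4 : 4^-1 <= a ^+ 2 by nra.
have : 4^-1 * b <= a ^+ 2 * b by rewrite ler_pM2r.
lra.
Qed.

Let L_incr n : (n + 5)%:R^-1 <= L n.+1 - L n.
Proof.
have h5 : 0 < (n + 5)%:R :> R by rewrite ltr0n addnS.
have h4 : 0 < (n + 4)%:R :> R by rewrite ltr0n addn4.
have := @le_ln1Dx R (- (n + 5)%:R^-1).
have -> : 1 - (n + 5)%:R^-1 = (n + 4)%:R / (n + 5)%:R :> R.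
  by rewrite !natrD; field; rewrite -natrD lt0r_neq0.
rewrite ln_div ?posrE // ltrN2 invf_lt1 // ltr1n => /(_ _).
rewrite /L addSn -addnS => h; rewrite lerBrDl -lerBrDr.
by move: h => /(_ ltac:(lia)); lra.
Qed.

(** The square of the logarithm makes the sum of [quota_seq n / 2 ^+ n] converge; the factor 8 gives
    [quota_seq_small]. *)
Definition quota_seq (n : nat) : R :=
  2 ^+ n / (8 * (n + 4)%:R * ln (n + 4)%:R ^+ 2).
(* Its decrements dominate [2 * quota_seq k / 2 ^+ k], so their sum telescopes. *)
Definition slack_seq (n : nat) : R := (4 * ln (n + 4)%:R)^-1.

Lemma ln_ge1 (n : nat) : (4 <= n)%N -> 1 <= ln n%:R :> R.
Proof. by move=> n4; have := L_ge1 (n - 4); rewrite /L subnK. Qed.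

Lemma quota_seq_gt0 n : 0 < quota_seq n.
Proof.
have l0 : 0 < ln (n + 4)%:R :> R by apply: lt_le_trans (L_ge1 n).
by rewrite divr_gt0 ?mulr_gt0 ?exprn_gt0 // ltr0n addn4.
Qed.

Lemma quota_seq0 : quota_seq 0 <= 1.
Proof.
have := L_ge1 0; rewrite /L /quota_seq expr0 mul1r => l1.
rewrite invf_le1; last by nra.
nra.
Qed.

Lemma slack_seq_ge0 n : 0 <= slack_seq n.
Proof. by have := L_ge1 n; rewrite /L /slack_seq invr_ge0; lra. Qed.

Lemma slack_seq0 : slack_seq 0 <= 2^-1.
Proof.
have := L_ge1 0; rewrite /L /slack_seq => l1.
by rewrite lef_pV2 ?posrE; lra.
Qed.

Lemma quota_seq_double n : quota_seq n.+1 <= 2 * quota_seq n.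
Proof.
rewrite /quota_seq exprS -!mulrA ler_pM2l // ler_pM2l ?exprn_gt0 //.
have := L_ge1 n; have := L_ge1 n.+1; have := L_incr n; rewrite /L.
have h4 : 0 < (n + 4)%:R :> R by rewrite ltr0n addn4.
have h5 : 0 < (n + 5)%:R^-1 :> R by rewrite invr_gt0 ltr0n addnS.
have h45 : (n + 4)%:R <= (n.+1 + 4)%:R :> R by rewrite ler_nat.
move=> h a1 b1.
rewrite lef_pV2 ?posrE ?mulr_gt0 ?exprn_gt0 //; try lra.
rewrite ler_pM2l // ler_pM ?ler0n ?sqr_ge0 //.
by rewrite ler_pXn2r ?nnegrE //; lra.
Qed.

Lemma quota_seq_small n : 4 * n.+1%:R * quota_seq n.+1 < 2 ^+ n.
Proof.
rewrite /quota_seq exprS.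
have := L_ge1 n.+1; rewrite /L.
set l := ln _ => l1.
have p0 : 0 < 2 ^+ n :> R by rewrite exprn_gt0.
have m0 : 0 < (n.+1 + 4)%:R :> R by rewrite ltr0n.
have m1 : n.+1%:R < (n.+1 + 4)%:R :> R by rewrite ltr_nat; lia.
have l2 : 1 <= l ^+ 2 by rewrite exprn_ege1.
have l0 : 0 < l by lra.
rewrite mulrA ltr_pdivrMr ?mulr_gt0 //.
rewrite (_ : 4 * _ * _ = 2 ^+ n * (8 * n.+1%:R)); last by ring.
by rewrite ltr_pM2l //; nra.
Qed.

(** With b = ln (n+4) and a = ln (n+5), 1/b - 1/a = (a - b)/(ab) >= 1/((n+5) a^2), from [L_incr] and
    b <= a. *)
Lemma quota_slack n :
  2 * quota_seq n.+1 <= 2 ^+ n.+1 * (slack_seq n - slack_seq n.+1).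
Proof.
rewrite /quota_seq /slack_seq.
have := L_ge1 n; have := L_ge1 n.+1; have := L_incr n; rewrite /L.
rewrite -(addSnnS n 4).
set a := ln _; set b := ln _; set m := _%:R => h a1 b1.
have m0 : 0 < m by rewrite ltr0n.
have p0 : 0 < 2 ^+ n.+1 :> R by rewrite exprn_gt0.
rewrite mulrCA ler_pM2l //.
have -> : (4 * b)^-1 - (4 * a)^-1 = (a - b) / (4 * b * a) by field; lra.
apply: (@le_trans _ _ (m^-1 / (4 * a * a))).
  by rewrite le_eqVlt; apply/orP; left; apply/eqP; field; lra.
have im0 : 0 < m^-1 by rewrite invr_gt0.
apply: ler_pM => //; rewrite ?invr_ge0; try nra.
rewrite lef_pV2 ?posrE; nra.
Qed.

(** For n >= 4, n + 4 is at most both 2n and n^2, so the denominator grows by at most 2 and 4: 8 * 2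
    * 4 = 64. *)
Lemma quota_seq_ge (n : nat) : (4 <= n)%N ->
  2 ^+ n / (64 * n%:R * ln n%:R ^+ 2) <= quota_seq n.
Proof.
move=> n4; rewrite /quota_seq ler_pM2l ?exprn_gt0 //.
have := L_ge1 (n - 4); rewrite /L subnK // => l1.
have h1 : (n + 4)%:R <= 2 * n%:R :> R by rewrite -natrM ler_nat; lia.
have n0 : 0 < n%:R :> R by rewrite ltr0n; lia.
have h2 : ln (n + 4)%:R <= 2 * ln n%:R :> R.
  rewrite mulr_natl -lnXn // ler_ln ?posrE ?exprn_gt0 ?ltr0n ?addn4 //; last lia.
  by rewrite -natrX ler_nat; nia.
have := L_ge1 n; rewrite /L; move: h2; set l := ln _; set l' := ln _ => h2 l1'.
have m0 : 0 < (n + 4)%:R :> R by rewrite ltr0n addn4.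
have q : l ^+ 2 <= 4 * l' ^+ 2 by nra.
have q0 : 0 < l ^+ 2 by nra.
rewrite lef_pV2 ?posrE ?mulr_gt0 ?exprn_gt0 //; try lra.
apply: (@le_trans _ _ (8 * (2 * n%:R) * (4 * l' ^+ 2))); last by lra.
by apply: ler_pM => //; lra.
Qed.

(** Serves to make 2^n / (n ln^2 n) at least 256, via ln n <= n. The induction uses (m+1)^3 <= 2 m^3
    for m >= 22. *)
Lemma cube_le_exp2 (n : nat) : (22 <= n)%N -> 256 * n%:R ^+ 3 <= 2 ^+ n :> R.
Proof.
elim: n => // n IH; rewrite leq_eqVlt => /predU1P[<-|]; first by lra.
rewrite ltnS => n22; have := IH n22.
have -> : n.+1%:R = n%:R + 1 :> R by rewrite natr1.
have -> : 2 ^+ n.+1 = 2 * 2 ^+ n :> R by rewrite exprS.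
have : 22%:R <= n%:R :> R by rewrite ler_nat.
move: (2 ^+ n) (n%:R : R) => p m m22 h.
have m2 : 22 * m <= m ^+ 2 by nra.
have m3 : 22 * m ^+ 2 <= m ^+ 3 by rewrite (exprS m 2) ler_wpM2r ?sqr_ge0.
have -> : (m + 1) ^+ 3 = m ^+ 3 + 3 * m ^+ 2 + 3 * m + 1 by ring.
lra.
Qed.

End quota_sequence.

(** * Comparison of the layer sizes with 2^n / (n log^46 n) *)

Theorem theorem2 (R : realType) :
  exists F : set (set nat),
    [/\ F `<=` subsets_of posnat,
        antichain F &
        (0 < limn_einf (fun n : nat =>
           ((count_in F n)%:R *
            (2 ^+ n / (n%:R * ln (n%:R : R) ^+ 46))^-1)%:E))%E].
Proof.
pose K n := Num.truncn (quota_seq R n).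
exists (layer_union K); split.
- exact: layer_union_pos.
- exact: layer_union_antichain.
(* With y = 2^n / (n ln^2 n), the count is at least y/128 - 1, hence at least y/256 once y >= 256,
   which holds from n = 22 on. *)
apply: (@limn_einf_gt0 R _ 256^-1 22) => // n n22.
have layer_ge : quota_seq R n / 2 - 1 <= (count_in (layer_union K) n)%:R.
  case: n n22 => // n _.
  apply: (@le_trans _ _ (size (layer K n))%:R); last first.
    by rewrite ler_nat count_in_layer_union.
  apply: (@size_layer_ge R (quota_seq R) (slack_seq R)) => [m||m|m|m||m].
  - exact/ltW/quota_seq_gt0.
  - exact: quota_seq0.
  - exact: quota_seq_double.
  - exact: quota_seq_small.
  - exact: slack_seq_ge0.
  - exact: slack_seq0.
  - exact: quota_slack.
have n0 : 0 < n%:R :> R by rewrite ltr0n; lia.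
have l1 : 1 <= ln n%:R :> R by apply: ln_ge1; lia.
have ln_n : ln n%:R <= n%:R :> R by rewrite ltW // ln_sublinear.
have q_ge : 2 ^+ n / (64 * n%:R * ln n%:R ^+ 2) <= quota_seq R n.
  by apply: quota_seq_ge; lia.
have p0 : 0 < 2 ^+ n :> R by rewrite exprn_gt0.
have d0 : 0 < n%:R * ln n%:R ^+ 2 :> R by rewrite mulr_gt0 // exprn_gt0; lra.
have y_ge4 : 256 * (n%:R * ln n%:R ^+ 2) <= 2 ^+ n :> R.
  apply: le_trans (cube_le_exp2 R n n22).
  rewrite ler_pM2l // (exprS _ 2) ler_pM2l //.
  by rewrite ler_pXn2r ?nnegrE //; lra.
(* Since ln n >= 1, a bound with ln^2 in the denominator gives the one with ln^46. *)
have d46 : n%:R * ln n%:R ^+ 2 <= n%:R * ln n%:R ^+ 46 :> R.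
  by rewrite ler_pM2l // ler_weXn2l.
rewrite ler_pdivlMr ?divr_gt0 //; last lra.
move: layer_ge q_ge; rewrite -(mulrA 64); move: (quota_seq R n) (count_in _ _)%:R.
move: (2 ^+ n) (n%:R * _ ^+ 2) (n%:R * ln _ ^+ 46) p0 d0 y_ge4 d46.
move=> p d D p0 d0 y d46 q c hc hq.
have : p / D <= p / d by rewrite ler_pM2l // lef_pV2 ?posrE //; lra.
have : 256 <= p / d by rewrite ler_pdivlMr.
have e : p / (64 * d) = p / d / 64 by rewrite invfM mulrAC mulrA.
rewrite e in hq; lra.
Qed.
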